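(* Let $G$ be the ordered complete graph on $[n]$. (i) If $n\ge 4$, there exists a $2$-coloring of the edges of $G$ which does not contain a monochromatic separated subtree with more than $\lceil n/2\rceil+1$ vertices. (ii) There exists a $2$-coloring of the edges of $G$ which does not contain a monochromatic nested subtree with more than $\frac{n+4}{2}$ vertices. (iii) There exists a $2$-coloring of the edges of $G$ which does not contain a monochromatic crossing subtree with more than $\frac{n+3}{2}$ vertices.
   Context: The ordered complete graph on $[n]=\{1,\dots,n\}$ is the complete graph with vertex set $[n]$, taken with its natural ordering; edges are written $(i,j)$ with $i<j$. A $2$-coloring assigns one of two colors to each edge; a subgraph is monochromatic if all its edges have the same color. Two edges are independent if they share no vertex. Independent edges $(a,b)$ and $(c,d)$ are crossing if $a<c<b<d$ or $c<a<d<b$; nested if $a<c<d<b$ or $c<a<b<d$; separated if $a<b<c<d$ or $c<d<a<b$. A subgraph is called crossing (resp. nested, separated) if any two of its independent edges are crossing (resp. nested, separated). A subtree is a (not necessarily spanning) subgraph that is a tree. *)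

(* Defs.v *)
From mathcomp Require Import all_boot all_order all_algebra.

Set Implicit Arguments.
Unset Strict Implicit.
Unset Printing Implicit Defensive.

(* Written with the Mathematical Components library.  The vertex set
   [n] = {1, ..., n} is represented by the ordered type 'I_n = {0, ..., n-1};
   only the order of the vertices matters. *)

Definition edge (n : nat) := {e : 'I_n * 'I_n | (e.1 < e.2)%N}.

Definition lo (n : nat) (e : edge n) : 'I_n := (val e).1.
Definition hi (n : nat) (e : edge n) : 'I_n := (val e).2.
Definition ends (n : nat) (e : edge n) : {set 'I_n} := [set lo e; hi e].

Definition independent_edges (n : nat) (e f : edge n) : bool :=
  [disjoint ends e & ends f].

Definition crossing_edges (n : nat) (e f : edge n) : bool :=
  [&& lo e < lo f, lo f < hi e & hi e < hi f]
  || [&& lo f < lo e, lo e < hi f & hi f < hi e].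

Definition nested_edges (n : nat) (e f : edge n) : bool :=
  [&& lo e < lo f, lo f < hi f & hi f < hi e]
  || [&& lo f < lo e, lo e < hi e & hi e < hi f].

Definition separated_edges (n : nat) (e f : edge n) : bool :=
  [&& lo e < hi e, hi e < lo f & lo f < hi f]
  || [&& lo f < hi f, hi f < lo e & lo e < hi e].

Record subgraph (n : nat) := Subgraph {
  verts : {set 'I_n};
  edges : {set edge n};
  edges_verts : forall e : edge n, e \in edges -> ends e \subset verts
}.

Definition adj (n : nat) (H : subgraph n) : rel 'I_n :=
  fun x y => [exists e in edges H, ends e == [set x; y]].

Definition connected (n : nat) (H : subgraph n) : Prop :=
  verts H != set0 /\
  forall x y : 'I_n, x \in verts H -> y \in verts H -> connect (adj H) x y.

(* A duplicate-free closed walk of length 2 runs back and forth along a single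
   edge, so only those of length at least 3 are cycles of the graph (there are
   none of length 1, since adj is irreflexive). *)
Definition acyclic (n : nat) (H : subgraph n) : Prop :=
  forall p : seq 'I_n, ucycle (adj H) p -> ~ (3 <= size p).

Definition is_tree (n : nat) (H : subgraph n) : Prop :=
  connected H /\ acyclic H.

Definition coloring (n : nat) := edge n -> bool.

Definition monochromatic (n : nat) (c : coloring n) (H : subgraph n) : Prop :=
  exists k : bool, forall e : edge n, e \in edges H -> c e = k.

Definition all_independent_pairs (n : nat) (r : rel (edge n)) (H : subgraph n) :
    Prop :=
  forall e f : edge n, e \in edges H -> f \in edges H ->
    independent_edges e f -> r e f.

Definition crossing (n : nat) (H : subgraph n) : Prop :=
  all_independent_pairs (@crossing_edges n) H.

Definition nested (n : nat) (H : subgraph n) : Prop :=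
  all_independent_pairs (@nested_edges n) H.

Definition separated (n : nat) (H : subgraph n) : Prop :=
  all_independent_pairs (@separated_edges n) H.

(* Main.v *)
(* In every coloring one color class splits into components on about n/2
   vertices; for the other one we bound the number of edges of a connected
   subgraph, which is at least its number of vertices minus one.

   (i) Split [n] into a left and a right half, and separate the edges inside
   the halves from those between them.  Two edges between the halves are never
   separated, so those of a separated subgraph pairwise meet and form a star.

   (ii), (iii) Split the edges according to the parity of their length.  In a
   crossing subgraph with odd lengths, the sums of the two endpoints are odd,
   pairwise distinct, and differ by at most n-1.  In a nested subgraph with odd
   lengths, the lengths are pairwise distinct unless some vertex b is the right
   end of one edge and the left end of another; then the neighbors of b span an
   interval [x, y] with y - x even, they all have the parity opposite to that
   of b, and the edges avoiding b contain [x, y] and have distinct lengths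
   greater than y - x. *)
Require Import Defs.
From mathcomp Require Import all_boot all_order all_algebra.
From mathcomp Require Import zify.

Set Implicit Arguments.
Unset Strict Implicit.
Unset Printing Implicit Defensive.

Lemma card_le_inj (T : finType) (A : {set T}) (f : T -> nat) (m : nat) :
  {in A &, injective f} -> {in A, forall x, f x < m} -> #|A| <= m.
Proof.
move=> f_inj f_lt; rewrite cardE -(size_map f) -[leqRHS](size_iota 0).
apply: uniq_leq_size.
  by rewrite map_inj_in_uniq ?enum_uniq // => x y; rewrite !mem_enum; apply: f_inj.
by move=> _ /mapP[x xA ->]; rewrite mem_iota f_lt // -mem_enum.
Qed.

(** * Edges and connected subgraphs *)

Section Edges.
Variable n : nat.
Implicit Types (e f : edge n) (H : subgraph n).

Lemma lo_lt_hi e : lo e < hi e.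
Proof. exact: (valP e). Qed.

Lemma edge_inj e f :
  lo e = lo f :> nat -> hi e = hi f :> nat -> e = f.
Proof.
move=> eq_lo eq_hi; apply: val_inj.
by rewrite [LHS]surjective_pairing [RHS]surjective_pairing;
   congr pair; apply: val_inj.
Qed.

Lemma disjoint_or_meet e f : independent_edges e f \/
  (lo e = lo f :> nat \/ lo e = hi f :> nat \/
   hi e = lo f :> nat \/ hi e = hi f :> nat).
Proof.
case: (boolP (independent_edges e f)) => [|dep]; [by left | right].
case/pred0Pn: dep => x; rewrite /= !inE => /andP[].
by case/orP => /eqP-> /orP[] /eqP->; auto.
Qed.

Lemma edges_lo H e : e \in edges H -> lo e \in verts H.
Proof. by move/edges_verts/subsetP; apply; rewrite !inE eqxx. Qed.

Lemma edges_hi H e : e \in edges H -> hi e \in verts H.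
Proof. by move/edges_verts/subsetP; apply; rewrite !inE eqxx orbT. Qed.

Lemma adj_ends H x y : adj H x y ->
  exists2 e, e \in edges H &
    (x = lo e /\ y = hi e) \/ (x = hi e /\ y = lo e).
Proof.
case/existsP=> e /andP[eH /eqP/setP eq_ends]; exists e => //.
have := lo_lt_hi e; have := eq_ends (lo e); have := eq_ends (hi e).
have := eq_ends y; have := eq_ends x; rewrite !inE !eqxx ?orbT /=.
case/orP=> /eqP-> /orP[]/eqP->; rewrite ?orbb; auto.
  by move/esym/eqP->; rewrite ltnn.
by move=> _ /esym/eqP->; rewrite ltnn.
Qed.

(** Applied below to membership in a growing vertex set, to the half containing a vertex, and to its
    parity. *)
Lemma connected_constant H (P : pred 'I_n) :
    connected H -> {in edges H, forall e, P (lo e) = P (hi e)} ->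
  {in verts H &, forall x y, P x = P y}.
Proof.
case=> _ conn const x y xV yV.
apply: (closed_connect (e := adj H)) (conn x y xV yV) => u v.
by case/adj_ends=> e /const; case=> eqP [][-> ->].
Qed.

(* Grow a vertex set one vertex at a time: each new vertex brings along an
   edge joining it to the previous ones. *)
Lemma connected_card H : connected H -> #|verts H| <= #|edges H| + 1.
Proof.
move=> connH; have [/set0Pn[r rV] _] := connH.
pose inside (S : {set 'I_n}) := [set e in edges H | ends e \subset S].
suff grow k : k < #|verts H| ->
    exists S : {set 'I_n}, [/\ S \subset verts H, r \in S, #|S| = k.+1
                             & k <= #|inside S|].
  have [|S [_ _ _ leS]] := grow #|verts H|.-1.
    by rewrite prednK // (cardD1 r) rV.
  have : #|inside S| <= #|edges H|.
    by apply: subset_leq_card; apply/subsetP=> e; rewrite inE => /andP[].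
  lia.
elim: k => [_|k IH ltkV].
  by exists [set r]; rewrite sub1set rV set11 cards1.
have [S [SV rS cardS leS]] := IH (ltnW ltkV).
(* If no edge left [S], the connected [H] would lie inside [S], which has too few vertices. *)
have [e eH lo_hi] : exists2 e, e \in edges H & (lo e \in S) != (hi e \in S).
  apply/exists_inP; apply: contraLR ltkV => /exists_inPn noexit.
  rewrite -leqNgt -cardS subset_leq_card //; apply/subsetP=> x xV.
  rewrite -(connected_constant (P := fun x => x \in S) connH _ rV xV) //.
  by move=> e /noexit /negPn/eqP.
have [x [xV xS eS]] : exists x,
    [/\ x \in verts H, x \notin S & ends e \subset x |: S].
  case: (boolP (lo e \in S)) lo_hi => loS; case: (boolP (hi e \in S)) => hiS // _.
    exists (hi e); split=> //; first exact: edges_hi.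
    by rewrite subUset !sub1set !inE loS eqxx orbT.
  exists (lo e); split=> //; first exact: edges_lo.
  by rewrite subUset !sub1set !inE hiS eqxx orbT.
exists (x |: S); split.
- by rewrite subUset sub1set xV.
- by rewrite !inE rS orbT.
- by rewrite cardsU1 xS cardS.
apply: leq_ltn_trans leS _; apply: proper_card; apply/properP; split.
  apply/subsetP=> f; rewrite !inE => /andP[-> /subset_trans]; apply.
  exact: subsetUr.
exists e; first by rewrite inE eH.
rewrite inE eH /= subUset !sub1set.
by case: (lo e \in S) lo_hi; case: (hi e \in S).
Qed.

Lemma independent_or_meet (r : rel (edge n)) H e f :
  all_independent_pairs r H -> e \in edges H -> f \in edges H ->
  r e f \/ (lo e = lo f :> nat \/ lo e = hi f :> nat \/
            hi e = lo f :> nat \/ hi e = hi f :> nat).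
Proof.
by move=> ind eH fH; case: (disjoint_or_meet e f) => [/(ind _ _ eH fH)|]; auto.
Qed.

(** * Coloring by halves *)

Definition half_coloring : coloring n :=
  fun e => (lo e < uphalf n) == (hi e < uphalf n).

Lemma halves_card H : connected H ->
  {in edges H, forall e, half_coloring e} -> #|verts H| <= uphalf n.
Proof.
move=> connH mono.
have const := connected_constant (P := fun x : 'I_n => x < uphalf n) connH
  (fun e eH => eqP (mono e eH)).
apply: (@card_le_inj _ _ (fun x : 'I_n => if x < uphalf n then x : nat
                                   else x - uphalf n)) => [x y|x] xV.
  by move=> yV /= /[!const x y xV yV] eqf; apply: val_inj => /=;
     have := const _ _ xV yV; case: ifP eqf; lia.
by have := ltn_ord x; case: ifP; lia.
Qed.

Lemma separated_card H : separated H ->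
  {in edges H, forall e, ~~ half_coloring e} -> #|edges H| <= uphalf n.
Proof.
move=> sepH mono.
have side e : e \in edges H -> lo e < uphalf n <= hi e.
  by move/mono; have := lo_lt_hi e; rewrite /half_coloring; lia.
have meet e f : e \in edges H -> f \in edges H ->
    lo e = lo f :> nat \/ hi e = hi f :> nat.
  move=> eH fH; have := side _ eH; have := side _ fH.
  by have := independent_or_meet sepH eH fH; rewrite /separated_edges; lia.
(* Two different left ends force a common right end, and then every further edge shares it;
   otherwise all left ends agree. *)
case: (boolP [exists e in edges H, exists f in edges H, lo e != lo f]).
  case/exists_inP=> e eH /exists_inP[f fH lo_neq].
  have lo_neqN : lo e <> lo f :> nat by move/val_inj/eqP; apply/negP.
  have hiE g : g \in edges H -> hi g = hi e :> nat.
    move=> gH; have := meet _ _ eH fH; have := meet _ _ gH eH.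
    by have := meet _ _ gH fH; lia.
  apply: (@card_le_inj _ _ (fun e => lo e : nat)) => [g h gH hH eq_lo|g /side].
    by apply: edge_inj; rewrite // !hiE.
  by case/andP.
move/exists_inPn=> same_lo.
have loE e f : e \in edges H -> f \in edges H -> lo e = lo f.
  by move=> eH fH; have /exists_inPn/(_ f fH)/negPn/eqP := same_lo e eH.
apply: (@card_le_inj _ _ (fun e => hi e - uphalf n)) => [e f eH fH eq_hi|e eH].
  apply: edge_inj; first by rewrite (loE e f).
  by have := side e eH; have := side f fH; lia.
by have := side e eH; have := ltn_ord (hi e); lia.
Qed.

(** * Coloring by parity of length *)

Definition parity_coloring : coloring n := fun e => odd (lo e) == odd (hi e).

Lemma parity_card H : connected H ->
  {in edges H, forall e, parity_coloring e} -> #|verts H| <= uphalf n.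
Proof.
move=> connH mono.
have const := connected_constant (P := fun x : 'I_n => odd x) connH
  (fun e eH => eqP (mono e eH)).
apply: (@card_le_inj _ _ (fun x : 'I_n => x./2)) => [x y|x] xV.
  by move=> yV eqf; apply: val_inj => /=; have := const x y xV yV; lia.
by have := ltn_ord x; lia.
Qed.

Lemma crossing_card H : crossing H ->
  {in edges H, forall e, ~~ parity_coloring e} -> #|edges H| <= uphalf n.
Proof.
move=> crossH mono.
case: (set_0Vmem (edges H)) => [->|[e0 e0H]]; first by rewrite cards0.
(* Ordering by the sum of the ends orders both ends, so equal sums force equal edges. *)
have crossE e f : e \in edges H -> f \in edges H ->
    lo e + hi e <= lo f + hi f ->
    [/\ lo e <= lo f, lo f <= hi e & hi e <= hi f].
  move=> eH fH; have := lo_lt_hi e; have := lo_lt_hi f.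
  have := independent_or_meet crossH eH fH; rewrite /crossing_edges.
  by move=> *; split; lia.
case: (arg_minnP (fun e => lo e + hi e) e0H) => m mH m_min.
have oddE e : e \in edges H -> odd (lo e + hi e).
  by move/mono; rewrite /parity_coloring; lia.
apply: (@card_le_inj _ _ (fun e => (lo e + hi e - (lo m + hi m))./2)).
  move=> e f eH fH eq_ef.
  have eq_sum : lo e + hi e = lo f + hi f.
    have := m_min e eH; have := m_min f fH; have := oddE _ mH.
    by have := oddE _ eH; have := oddE _ fH; lia.
  have [] := crossE e f eH fH (eq_leq eq_sum).
  have [] := crossE f e fH eH (eq_leq (esym eq_sum)).
  by move=> *; apply: edge_inj; lia.
(* As [lo e <= hi m], the sums for [e] and [m] differ by at most [hi e - lo m]. *)
move=> e eH; have [] := crossE m e mH eH (m_min e eH).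
by have := ltn_ord (hi e); lia.
Qed.

Lemma nested_card H : nested H ->
  {in edges H, forall e, ~~ parity_coloring e} -> #|edges H| <= n./2 + 1.
Proof.
move=> nestH mono.
have oddE e : e \in edges H -> exists k, hi e = lo e + k.*2.+1 :> nat.
  move/mono; have := lo_lt_hi e; rewrite /parity_coloring => lt_e odd_e.
  by exists (hi e - lo e)./2; lia.
have nestE e f : e \in edges H -> f \in edges H ->
    lo e < lo f /\ hi f < hi e \/ lo f < lo e /\ hi e < hi f \/
    lo e = lo f :> nat \/ lo e = hi f :> nat \/
    hi e = lo f :> nat \/ hi e = hi f :> nat.
  move=> eH fH; case: (independent_or_meet nestH eH fH); last by auto.
  by case/orP=> /and3P[]; auto.
case: (boolP [exists e in edges H, exists f in edges H, hi e == lo f]).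
  case/exists_inP=> l0 l0H /exists_inP[r0 r0H /eqP eq_b].
  pose b := hi l0.
  pose lP := [pred e | (e \in edges H) && (hi e == b)].
  pose rP := [pred e | (e \in edges H) && (lo e == b)].
  have l0P : lP l0 by rewrite /= l0H eqxx.
  have r0P : rP r0 by rewrite /= r0H -eq_b eqxx.
  (* [l] and [r] are the longest edges on either side of [b]. *)
  case: (arg_minnP (fun e => lo e : nat) l0P) => l /andP[lH /eqP lb] l_min.
  case: (arg_maxnP (fun e => hi e : nat) r0P) => r /andP[rH /eqP rb] r_max.
  (* Left of [b], such an edge would be separated from [r]; right of [b], from [l]. So it passes
     over [b] and must cover both. *)
  have avoid e : e \in edges H -> hi e != b -> lo e != b ->
      lo e <= lo l /\ hi r <= hi e.
    move=> eH /eqP hi_b /eqP lo_b; have := lo_lt_hi e.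
    have {}hi_b : hi e <> b :> nat by move/val_inj.
    have {}lo_b : lo e <> b :> nat by move/val_inj.
    have := lo_lt_hi l; have := lo_lt_hi r; rewrite lb rb.
    have := nestE e l eH lH; have := nestE e r eH rH; rewrite lb rb.
    move: (lo e : nat) (hi e : nat) (lo l : nat) (hi r : nat) (b : nat) lo_b hi_b.
    clear; lia.
  have [p bE] := oddE l lH; have [q rE] := oddE r rH; rewrite lb rb in bE rE.
  (* An edge at b is labelled by the position of its other end in [lo l, hi r],
     the remaining ones by their length, which exceeds hi r - lo l. *)
  pose f e := if hi e == b then (lo e - lo l)./2
              else if lo e == b then (hi e - lo l)./2
              else (hi e - lo e)./2.+1.
  (* The three kinds of labels fill disjoint ranges: up to [p], from [p + 1] to [p + q + 1], and
     beyond. *)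
  have fP e : e \in edges H -> exists2 k, hi e = lo e + k.*2.+1 :> nat &
      [\/ [/\ hi e = b :> nat, k <= p & f e = p - k],
          [/\ lo e = b :> nat, k <= q & f e = p + k.+1]
        | [/\ lo e <= lo l, hi r <= hi e & f e = k.+1]].
    move=> eH; have [k eE] := oddE e eH; exists k => //; rewrite /f.
    case: ifPn => [/eqP hib|nhib].
      have := l_min e; rewrite /= eH hib eqxx => /(_ isT) le_l.
      by constructor 1; rewrite -hib in bE *; clear - bE eE le_l; split; lia.
    case: ifPn => [/eqP lob|nlob].
      have := r_max e; rewrite /= eH lob eqxx => /(_ isT) le_r.
      constructor 2; rewrite -lob in bE rE *.
      by clear - bE rE eE le_r; split; lia.
    have [] := avoid e eH nhib nlob; constructor 3; split=> //.
    by rewrite eE; clear; lia.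
  apply: (@card_le_inj _ _ f) => [e g eH gH|e eH].
    have [k eE ecase] := fP e eH; have [j gE gcase] := fP g gH.
    have := nestE e g eH gH => nest_eg eq_f.
    suff [] : lo e = lo g :> nat /\ hi e = hi g :> nat by apply: edge_inj.
    move: (lo e : nat) (hi e : nat) (lo g : nat) (hi g : nat) (f e) (f g)
      (lo l : nat) (hi r : nat) (b : nat) eE gE bE rE ecase gcase nest_eg eq_f.
    clear=> le he lg hg fe fg x y c -> -> -> ->.
    by case=> -[? ? ->]; case=> -[? ? ->]; lia.
  have [k eE ecase] := fP e eH; have := ltn_ord (hi e); have := ltn_ord (hi r).
  rewrite eE rE bE; clear - eE rE bE ecase.
  by case: ecase => -[? ? ->]; lia.
move/exists_inPn=> noconsec.
have hi_lo e f : e \in edges H -> f \in edges H -> hi e <> lo f :> nat.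
  move=> eH fH eq_ef; have /exists_inPn/(_ f fH)/negP := noconsec e eH.
  by apply; apply/eqP/val_inj.
(* Edges of equal length are not nested and here not consecutive, so they share a left or a right
   end and coincide. *)
apply: (@card_le_inj _ _ (fun e => (hi e - lo e)./2)) => [e f eH fH eq_ef|e eH].
  have [k eE] := oddE e eH; have [j fE] := oddE f fH.
  have := hi_lo _ _ eH fH; have := hi_lo _ _ fH eH.
  have := nestE e f eH fH.
  by move=> *; apply: edge_inj; lia.
by have [k eE] := oddE e eH; have := ltn_ord (hi e); lia.
Qed.

End Edges.

(* uphalf n is n/2 rounded up. *)
Theorem theorem2p4 (n : nat) :
  (4 <= n ->
     exists c : coloring n,
       ~ exists T : subgraph n,
           [/\ is_tree T, monochromatic c T, separated T
             & uphalf n + 1 < #|verts T|])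
  /\
  (exists c : coloring n,
     ~ exists T : subgraph n,
         [/\ is_tree T, monochromatic c T, nested T
           & ((n%:R + 4) / 2 < (#|verts T|%:R : rat))%R])
  /\
  (exists c : coloring n,
     ~ exists T : subgraph n,
         [/\ is_tree T, monochromatic c T, crossing T
           & ((n%:R + 3) / 2 < (#|verts T|%:R : rat))%R]).
Proof.
have clear_denom k m : ((n%:R + k%:R) / 2 < (m%:R : rat))%R -> n + k < m * 2.
  by rewrite Num.Theory.ltr_pdivrMr // -!GRing.natrD -GRing.natrM Num.Theory.ltr_nat.
split=> [_|]; last split.
- exists (@half_coloring n) => -[T [[connT _] [k mono] sepT]].
  have := connected_card connT; case: k mono => mono.
    by have := halves_card connT mono; lia.
  by have := separated_card sepT (fun e eT => negbT (mono e eT)); lia.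
- exists (@parity_coloring n) => -[T [[connT _] [k mono] nestT /clear_denom]].
  have := connected_card connT; case: k mono => mono.
    by have := parity_card connT mono; lia.
  by have := nested_card nestT (fun e eT => negbT (mono e eT)); lia.
- exists (@parity_coloring n) => -[T [[connT _] [k mono] crossT /clear_denom]].
  have := connected_card connT; case: k mono => mono.
    by have := parity_card connT mono; lia.
  by have := crossing_card crossT (fun e eT => negbT (mono e eT)); lia.
Qed.
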